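(* Let $E$ be a locally compact Hausdorff space with Borel $\sigma$-algebra $\mathcal{B}$, let $C_c^+$ be the set of compactly supported continuous maps from $E$ to $\mathbb{R}_+$, and let $V : C_c^+ \rightarrow \mathbb{R}_+$ be a linear form on $C_c^+$. Then there exists a unique regular maxitive measure $\nu$ on $\mathcal{B}$ such that $$V(f) = \int^{\infty} f\,d\nu \quad\text{for all } f \in C_c^+.$$ Moreover, $\nu$ takes finite values on compact subsets of $E$.
   Context: Here $\oplus$ denotes (pointwise) maximum/supremum. A linear form on $C_c^+$ is a map $V:C_c^+\to\mathbb{R}_+$ with $V(f\oplus g)=V(f)\oplus V(g)$ and $V(t f)=t\,V(f)$ for all $f,g\in C_c^+$, $t\in\mathbb{R}_+$. A maxitive measure on $\mathcal{B}$ is a map $\nu:\mathcal{B}\to[0,\infty]$ with $\nu(\emptyset)=0$ and $\nu(B_1\cup B_2)=\nu(B_1)\oplus\nu(B_2)$ for all $B_1,B_2\in\mathcal{B}$. It is regular if for all $B\in\mathcal{B}$, $\nu(B)=\sup\{\nu(K):K\subset B,\ K\text{ compact}\}=\inf\{\nu(G):G\supset B,\ G\text{ open}\}$. The Shilkret integral of a Borel measurable map $f:E\to[0,\infty]$ is $\int^{\infty}f\,d\nu=\sup_{t\in\mathbb{R}_+}t\,\nu(\{f>t\})$ (with $0\cdot\infty=0$). *)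

(* Defs.v *)
From HB Require Import structures.
From mathcomp Require Import all_boot all_order all_algebra.
From mathcomp Require Import all_classical all_reals all_analysis.

Set Implicit Arguments.
Unset Strict Implicit.
Unset Printing Implicit Defensive.

Import Order.TTheory GRing.Theory Num.Theory.
Import numFieldNormedType.Exports.

Local Open Scope classical_set_scope.
Local Open Scope ring_scope.

(* The library's [open.-sigma.-measurable] is not used because it requires a
   pointed, hence nonempty, carrier. *)
Definition borel {E : topologicalType} : set (set E) := <<s open >>.

Definition Ccplus {E : topologicalType} {R : realType} : set (E -> R) :=
  [set f : E -> R | [/\ continuous f, forall x, 0 <= f x
                     & compact (closure [set x | f x != 0])]].

(* V is only constrained on Ccplus; its values elsewhere are irrelevant. *)
Definition linear_form {E : topologicalType} {R : realType}
    (V : (E -> R) -> R) : Prop :=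
  [/\ forall f, Ccplus f -> 0 <= V f,
      forall f g, Ccplus f -> Ccplus g ->
        V (f \max g) = Num.max (V f) (V g)
    & forall (t : R) f, 0 <= t -> Ccplus f ->
        V (fun x => t * f x) = t * V f].

(* As for the library's measures, nu is a function on all subsets of E that is
   only meaningful on Borel sets. *)
Definition maxitive_measure {E : topologicalType} {R : realType}
    (nu : set E -> \bar R) : Prop :=
  [/\ forall B, borel B -> (0 <= nu B)%E,
      nu set0 = 0%E
    & forall B1 B2, borel B1 -> borel B2 ->
        nu (B1 `|` B2) = maxe (nu B1) (nu B2)].

(* Compact sets are closed, hence Borel, when E is Hausdorff. *)
Definition regular_maxitive {E : topologicalType} {R : realType}
    (nu : set E -> \bar R) : Prop :=
  forall B, borel B ->
    nu B = ereal_sup [set nu K | K in [set K | K `<=` B /\ compact K]] /\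
    nu B = ereal_inf [set nu G | G in [set G | B `<=` G /\ open G]].

(* In [\bar R], 0 * +oo = 0. *)
Definition shilkret_integral {E : topologicalType} {R : realType}
    (nu : set E -> \bar R) (f : E -> \bar R) : \bar R :=
  ereal_sup [set (t%:E * nu [set x | (t%:E < f x)%E])%E
            | t in [set t : R | 0 <= t]].

Definition represents {E : topologicalType} {R : realType}
    (nu : set E -> \bar R) (V : (E -> R) -> R) : Prop :=
  forall f, Ccplus f -> (V f)%:E = shilkret_integral nu (EFin \o f).

(* Main.v *)
(** The measure is [nu B = sup_B c], where [c x] is the infimum of [V f] over
    the [f] in [Ccplus] with [f x >= 1].  The function [c] is upper
    semicontinuous, which alone makes [nu] outer regular: if [sup_B c < s] then
    [{c < s}] is an open set containing [B].  Clearly [f x * c x <= V f];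
    conversely, if [s > sup_x f x * c x], every point [x] has some [g] with
    [V g < s] and [f < g] near [x], and the maximum of finitely many such [g]
    dominates [f] on its support, so [V f <= s].  Uniqueness holds because a
    regular maxitive measure is the supremum of its values on singletons (by
    compactness), and Urysohn functions recover these values from [V]. *)
Require Import Defs.
From HB Require Import structures.
From mathcomp Require Import all_boot all_order all_algebra.
From mathcomp Require Import all_classical all_reals all_analysis.

Set Implicit Arguments.
Unset Strict Implicit.
Unset Printing Implicit Defensive.

Import Order.TTheory GRing.Theory Num.Theory.
Import numFieldNormedType.Exports.

Local Open Scope classical_set_scope.
Local Open Scope ring_scope.

(** * Extended reals, compactness and Borel sets *)

Lemma ereal_between (R : realType) (a b : \bar R) :
  (0 <= a)%E -> (a < b)%E -> exists r : R, (a < r%:E < b)%E.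
Proof.
case: a b => [a| |] [b| |] //= a0 ab.
- exists ((a + b) / 2); rewrite !lte_fin.
  by rewrite lte_fin in ab; rewrite !midf_lt.
- by exists (a + 1); rewrite lte_fin ltrDl ltr01 ltry.
Qed.

(* The sets whose complement in [K] satisfies [P] form a filter, which is
   improper because the local hypothesis prevents it from
   clustering in [K]. *)
Lemma compact_ind (E : topologicalType) (P : set E -> Prop) (K : set E) :
  compact K -> P set0 -> (forall A B, A `<=` B -> P B -> P A) ->
  (forall A B, P A -> P B -> P (A `|` B)) ->
  (forall x, K x -> exists2 U, nbhs x U & P U) -> P K.
Proof.
move=> cK P0 Psub PU locP; apply: contrapT => nPK.
pose F : set_system E := fun A => P (K `\` A).
have FF : ProperFilter F.
  apply: Build_ProperFilter.
  - by rewrite /F setD0.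
  - split; first by rewrite /F setDT.
    + by move=> A B FA FB; rewrite /F setDIr; exact: PU.
    + by move=> A B AB; apply: Psub => x [Kx nB]; split=> // /AB.
have [|x [Kx clx]] := cK F FF; first by rewrite /F setDv.
have [U xU PU'] := locP x Kx.
have FU : F (~` U) by apply: Psub PU' => y [_ /contrapT].
by have [y []] := clx _ _ FU xU.
Qed.

Lemma open_borel (E : topologicalType) (A : set E) : open A -> borel A.
Proof. by move=> oA; apply: sub_sigma_algebra. Qed.

Lemma closed_borel (E : topologicalType) (A : set E) : closed A -> borel A.
Proof.
move=> cA; rewrite -(setCK A) -setTD; apply: sigma_algebraCD.
by apply: open_borel; exact: closed_openC.
Qed.

(** * Maxitive measures that are suprema of a density *)

Section SupDensity.
Variables (R : realType) (E : topologicalType) (d : E -> \bar R).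

(** The maximum with [0] matters for the empty set, whose supremum in the extended reals is
    [-oo]. *)
Definition sup_density (B : set E) : \bar R :=
  maxe 0%E (ereal_sup (d @` B)).

Lemma sup_density_le B z :
  (0 <= z)%E -> (forall x, B x -> (d x <= z)%E) -> (sup_density B <= z)%E.
Proof.
move=> z0 dz; rewrite ge_max z0 /=; apply/ereal_supP => _ [x Bx <-].
exact: dz.
Qed.

Lemma sup_density_ge0 B : (0 <= sup_density B)%E.
Proof. by rewrite le_max lexx. Qed.

Lemma sup_density_ub B x : B x -> (d x <= sup_density B)%E.
Proof.
by move=> Bx; rewrite le_max ereal_sup_ubound ?orbT//; exists x.
Qed.

Lemma sup_density_mono A B : A `<=` B -> (sup_density A <= sup_density B)%E.
Proof.
move=> AB; apply: sup_density_le => [|x /AB]; first exact: sup_density_ge0.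
exact: sup_density_ub.
Qed.

Lemma sup_density0 : sup_density set0 = 0%E.
Proof.
by apply/le_anti; rewrite sup_density_ge0 andbT; apply: sup_density_le.
Qed.

Lemma sup_densityU A B :
  sup_density (A `|` B) = maxe (sup_density A) (sup_density B).
Proof.
apply/le_anti/andP; split; last first.
  by rewrite ge_max !sup_density_mono.
apply: sup_density_le => [|x [|] /sup_density_ub dx].
- by rewrite le_max sup_density_ge0.
- by rewrite le_max dx.
- by rewrite le_max dx orbT.
Qed.

Lemma sup_density_maxitive : maxitive_measure sup_density.
Proof.
split=> [B _||A B _ _]; [exact: sup_density_ge0|exact: sup_density0|].
exact: sup_densityU.
Qed.

Hypothesis d_ge0 : forall x, (0 <= d x)%E.
Hypothesis d_usc : forall x (s : R),
  (d x < s%:E)%E -> nbhs x [set y | (d y < s%:E)%E].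

(** Inner regularity needs only singletons, which are compact; outer regularity uses the open
    sublevel sets of [d]. *)
Lemma sup_density_regular : regular_maxitive sup_density.
Proof.
move=> B _; split.
- apply/le_anti/andP; split.
    apply: sup_density_le => [|x Bx]; apply: le_ereal_sup_tmp.
      (* The bound [0] comes from the empty compact set, as [B] may have no point. *)
      exists 0%E => //; exists set0; last exact: sup_density0.
      by split; [exact: sub0set|exact: compact0].
    exists (sup_density [set x]); last by apply: sup_density_ub.
    by exists [set x] => //; split; [move=> _ ->|exact: compact_set1].
  by apply/ereal_supP => _ [K [KB _] <-]; exact: sup_density_mono.
- apply/le_anti/andP; split.
    by apply/ereal_infP => _ [G [BG _] <-]; apply: sup_density_mono.
  rewrite leNgt; apply/negP => /(ereal_between (sup_density_ge0 B)).
  move=> [s /andP[Bs]]; apply/negP; rewrite -leNgt.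
  apply: ge_ereal_inf; exists (sup_density [set y | (d y < s%:E)%E]).
    exists [set y | (d y < s%:E)%E] => //; split.
      by move=> x /sup_density_ub dx /=; exact: le_lt_trans Bs.
    by rewrite openE => x /d_usc.
  apply: sup_density_le => [|x /ltW//].
  exact: le_trans (sup_density_ge0 B) (ltW Bs).
Qed.

(** Upper semicontinuity bounds [d] by a real number near each point, and finitely many such bounds
    suffice on [K]. *)
Lemma sup_density_compact K : (forall x, (d x < +oo)%E) ->
  compact K -> (sup_density K < +oo)%E.
Proof.
move=> d_fin cK.
apply: (compact_ind (P := fun A => (sup_density A < +oo)%E) cK).
- by rewrite sup_density0.
- by move=> A B /sup_density_mono; exact: le_lt_trans.
- by move=> A B Aoo Boo; rewrite sup_densityU gt_max Aoo Boo.
move=> x _; have [s /andP[xs _]] := ereal_between (d_ge0 x) (d_fin x).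
exists [set y | (d y < s%:E)%E]; first exact: d_usc.
apply: (@le_lt_trans _ _ s%:E); last exact: ltry.
by apply: sup_density_le => [|y /ltW//]; exact: le_trans (d_ge0 x) (ltW xs).
Qed.

End SupDensity.

(** * Regular maxitive measures are determined by singletons *)

Section RegularMaxitive.
Variables (R : realType) (E : topologicalType) (hE : hausdorff_space E).
Variables (mu : set E -> \bar R).
Hypotheses (mu_max : maxitive_measure mu) (mu_reg : regular_maxitive mu).

Lemma maxitive_mono A B :
  borel A -> borel B -> A `<=` B -> (mu A <= mu B)%E.
Proof.
case: mu_max => _ _ muU bA bB /setUidPr <-.
by rewrite muU// le_max lexx.
Qed.

Lemma set1_borel (x : E) : borel [set x].
Proof.
apply: closed_borel; apply: accessible_closed_set1.
exact: hausdorff_accessible.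
Qed.

(** Inner regularity reduces the upper bound to compact [K]. Outer regularity at singletons
    surrounds each point of [K] by an open set of measure below [s], and finitely many of these
    cover [K]. *)
Lemma regular_maxitive_sup_density B :
  borel B -> mu B = sup_density (fun x => mu [set x]) B.
Proof.
have [mu0 mu_set0 muU] := mu_max => bB.
apply/le_anti/andP; split; last first.
  apply: sup_density_le => [|x Bx]; first exact: mu0.
  by apply: maxitive_mono => //; [exact: set1_borel|move=> _ ->].
set S := sup_density _ _; have S0 : (0 <= S)%E by exact: sup_density_ge0.
have [-> _] := mu_reg bB; apply/ereal_supP => _ [K [KB cK] <-].
rewrite leNgt; apply/negP => /(ereal_between S0)[s /andP[Ss]].
apply/negP; rewrite -leNgt.
(* The induction passes through arbitrary sets, where [mu] need not be monotone, so the bound is put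
   on an open superset. *)
suff [G [oG KG Gs]] : exists G, [/\ open G, K `<=` G & (mu G < s%:E)%E].
  apply/ltW/(le_lt_trans _ Gs); apply: maxitive_mono => //.
    by apply: closed_borel; exact: compact_closed.
  exact: open_borel.
apply: (compact_ind (P := fun A => exists G,
  [/\ open G, A `<=` G & (mu G < s%:E)%E]) cK).
- exists set0; rewrite mu_set0.
  by split=> //; [exact: open0|exact: le_lt_trans Ss].
- by move=> A A' AA' [G [oG A'G Gs]]; exists G; split=> // x /AA'/A'G.
- move=> A A' [G [oG AG Gs]] [G' [oG' AG' Gs']]; exists (G `|` G'); split.
  + exact: openU.
  + exact: setUSS.
  + by rewrite muU ?gt_max ?Gs//; exact: open_borel.
move=> x Kx.
have : (mu [set x] < s%:E)%E.
  apply: le_lt_trans Ss.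
  exact: (sup_density_ub (fun x => mu [set x])) (KB _ Kx).
have [_ ->] := mu_reg (set1_borel x).
move=> /ereal_inf_ltP[_ [G [xG oG] <-] Gs]; exists G; last by exists G; split.
by apply: open_nbhs_nbhs; split=> //; exact: xG.
Qed.

End RegularMaxitive.

(** * Continuous functions with compact support *)

Section LinearForm.
Variables (R : realType) (E : topologicalType).
Hypotheses (lcE : locally_compact [set: E]) (hE : hausdorff_space E).
Implicit Types f g : E -> R.

Lemma closure_compact_sub (A B : set E) :
  A `<=` B -> compact (closure B) -> compact (closure A).
Proof.
move=> /closureS AB cB; apply: subclosed_compact AB => //.
exact: closed_closure.
Qed.

Lemma Ccplus0 : Ccplus (fun _ : E => 0 : R).
Proof.
split=> //; first by move=> x; exact: cvg_cst.
rewrite [X in closure X](_ : _ = set0) ?closure0//; first exact: compact0.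
by rewrite -subset0 => x /=; rewrite eqxx.
Qed.

Lemma Ccplus_max f g : Ccplus f -> Ccplus g -> Ccplus (f \max g).
Proof.
move=> [cf f0 kf] [cg g0 kg]; split.
- by move=> x; apply: continuous_max; [exact: cf|exact: cg].
- by move=> x; rewrite le_max f0.
apply: (@closure_compact_sub _ ([set x | f x != 0] `|` [set x | g x != 0])).
  by move=> x /=; rewrite maxEle; case: ifP => _; [right|left].
by rewrite closureU; exact: compactU.
Qed.

Lemma CcplusZ (t : R) f : 0 <= t -> Ccplus f -> Ccplus (fun x => t * f x).
Proof.
move=> t0 [cf f0 kf]; split.
- by move=> x; apply: cvgM; [exact: cvg_cst|exact: cf].
- by move=> x; rewrite mulr_ge0.
apply: closure_compact_sub kf => x /=; apply: contra => /eqP ->.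
by rewrite mulr0.
Qed.

(** Urysohn separation of [x] from the complement of an open [O] contained in [U] and in a closed
    compact neighbourhood [W], which keeps the support compact. *)
Lemma Ccplus_bump x (U : set E) : nbhs x U ->
  exists f, [/\ Ccplus f, f x = 1, forall y, f y <= 1
    & [set y | f y != 0] `<=` U].
Proof.
move=> xU.
have [W xW [cW clW]] := lcE (I : setT x).
have {}xW : nbhs x W.
  have {}xW : nbhs x [set y | setT y -> W y] := xW.
  by apply: filterS xW => y /(_ I).
pose O := (U `&` W)°.
have Ox : O x by apply: nbhs_singleton; apply: nbhs_interior; exact: filterI.
have clO : closed (~` O) by apply: open_closedC; exact: open_interior.
have := @locally_compact_completely_regular E R lcE hE x (~` O) clO.
move=> /(_ (fun nO => nO Ox)) /(@uniform_separatorP _ R).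
move=> [g [cg g01 gx gO]].
have gb y : 0 <= g y <= 1.
  by have /= := g01 (g y) (ex_intro2 _ _ y I erefl); rewrite in_itv.
have sO : [set y | 1 - g y != 0] `<=` O.
  move=> y /=; apply: contraNP => nOy.
  by rewrite (gO (g y)) ?subrr//; exists y.
(* The separating function [g] is [0] at [x] and [1] off [O]. *)
exists (fun y => 1 - g y); split.
- split.
  + by move=> y; apply: cvgB; [exact: cvg_cst|exact: cg].
  + by move=> y; rewrite subr_ge0; case/andP: (gb y).
  + apply: (@closure_compact_sub _ W); last by move/closure_id : clW => <-.
    by move=> y /sO /interior_subset[].
- by rewrite (gx (g x)) ?subr0//; exists x.
- by move=> y; rewrite gerBl; case/andP: (gb y).
- by move=> y /sO /interior_subset[].
Qed.

(** * The density of a linear form *)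

Variable V : (E -> R) -> R.
Hypothesis hV : linear_form V.

Lemma linear_form_ge0 f : Ccplus f -> 0 <= V f.
Proof. by case: hV => + _ _; apply. Qed.

Lemma linear_form_mono f g : Ccplus f -> Ccplus g ->
  (forall x, f x <= g x) -> V f <= V g.
Proof.
case: hV => _ Vmax _ cf cg fg.
have -> : g = f \max g by apply/funext => x /=; rewrite max_r.
by rewrite Vmax// le_max lexx.
Qed.

Lemma linear_form0 : V (fun _ => 0) = 0.
Proof.
case: hV => _ _ VZ; rewrite -[RHS](mul0r (V (fun=> 0))).
rewrite -VZ//; last exact: Ccplus0.
by congr V; apply/funext => x; rewrite mul0r.
Qed.

Definition form_density (x : E) : \bar R :=
  ereal_inf [set (V f)%:E | f in [set f | Ccplus f /\ 1 <= f x]].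

Lemma form_density_ge0 x : (0 <= form_density x)%E.
Proof.
by apply/ereal_infP => _ [f [cf _] <-]; rewrite lee_fin linear_form_ge0.
Qed.

Lemma form_density_lt x s : (form_density x < s%:E)%E ->
  exists f, [/\ Ccplus f, 1 <= f x & V f < s].
Proof.
by move=> /ereal_inf_ltP[_ [f [cf fx] <-]]; rewrite lte_fin => fs; exists f.
Qed.

Lemma form_density_lty x : (form_density x < +oo)%E.
Proof.
have [f [cf fx _ _]] := Ccplus_bump (@filterT _ (nbhs x) _).
apply/ereal_inf_ltP; exists (V f)%:E; [|exact: ltry].
by exists f => //; split; rewrite ?fx.
Qed.

(** The function [t^-1 * f] competes in the infimum at [x]. *)
Lemma form_density_scale x f (t : R) : 0 < t -> Ccplus f -> t <= f x ->
  (t%:E * form_density x <= (V f)%:E)%E.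
Proof.
move=> t0 cf tf; have ti : 0 <= t^-1 by rewrite invr_ge0 ltW.
rewrite -lee_pdivlMl// -EFinM; apply: ge_ereal_inf.
exists (t^-1 * V f)%:E => //; exists (fun y => t^-1 * f y).
  by split; [exact: CcplusZ|rewrite ler_pdivlMl// mulr1].
by case: hV => _ _ ->.
Qed.

Lemma lt_nbhs f g x : continuous f -> continuous g -> f x < g x ->
  nbhs x [set y | f y < g y].
Proof.
move=> cf cg; rewrite -subr_gt0 => fg.
have fgx : nbhs x [set y | 0 < (g - f) y].
  exact: cvgr_gt _ (cvgB (cg x) (cf x)) _ fg.
by apply: filterS fgx => y /=; rewrite subr_gt0.
Qed.

(** Some [f] with [1 <= f x] has [V f < r < s]. It exceeds [r / s] near [x], so its multiple by
    [s / r] competes in the infimum at nearby points, with value below [s]. *)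
Lemma form_density_usc x (s : R) : (form_density x < s%:E)%E ->
  nbhs x [set y | (form_density y < s%:E)%E].
Proof.
move=> /[dup] xs /(ereal_between (form_density_ge0 x))[r /andP[xr]].
rewrite lte_fin => rs.
have r0 : 0 < r by rewrite -lte_fin (le_lt_trans _ xr)// form_density_ge0.
have s0 : 0 < s by exact: lt_trans rs.
have [f [cf fx Vf]] := form_density_lt xr.
have rsf : r / s < f x by rewrite (lt_le_trans _ fx)// ltr_pdivrMr// mul1r.
have [ctf _ _] := cf.
have rsfx : nbhs x [set y | r / s < f y].
  by apply: lt_nbhs => // y; exact: cvg_cst.
apply: filterS rsfx => y /= /ltW rsy.
have := form_density_scale (divr_gt0 r0 s0) cf rsy.
rewrite -lee_pdivlMl ?divr_gt0// => /le_lt_trans; apply.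
by rewrite -EFinM lte_fin invf_div -mulrAC ltr_pdivrMr// ltr_pM2l.
Qed.

(* Slack between two levels [r < s] gives a strict inequality at [x], which
   then persists near [x]. *)
Lemma local_domination f x (r s : R) : Ccplus f -> 0 < r < s ->
  (0 < f x -> (form_density x < (r / f x)%:E)%E) ->
  exists g, [/\ Ccplus g, V g < s & f x < g x].
Proof.
move=> cf /andP[r0 rs] dx; have s0 : 0 < s by exact: lt_trans rs.
have VZ : forall t g, 0 <= t -> Ccplus g -> V (fun x => t * g x) = t * V g.
  by case: hV.
have [_ f0 _] := cf.
have [fx0|fx0] := eqVneq (f x) 0.
  have [g [cg gx _ _]] := Ccplus_bump (@filterT _ (nbhs x) _).
  (* Adding [1] keeps the divisor positive even if [V g = 0]. *)
  have V1 : 0 < V g + 1 by rewrite ltr_wpDl// linear_form_ge0.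
  have t0 : 0 < s / (V g + 1) by exact: divr_gt0.
  exists (fun y => s / (V g + 1) * g y); split; last by rewrite fx0 gx mulr1.
    by apply: CcplusZ => //; exact: ltW.
  rewrite VZ ?ltW// mulrAC ltr_pdivrMr// ltr_pM2l//.
  by rewrite ltrDl.
have fx : 0 < f x by rewrite lt_neqAle eq_sym fx0 f0.
have [g [cg gx Vg]] := form_density_lt (dx fx).
(* This factor turns [V g < r / f x] into a value below [s], and lifts [g x >= 1] strictly above
   [f x]. *)
have t0 : 0 < f x * (s / r) by rewrite mulr_gt0// divr_gt0.
exists (fun y => f x * (s / r) * g y); split.
- by apply: CcplusZ => //; exact: ltW.
- rewrite VZ ?(ltW t0)// (@lt_le_trans _ _ (f x * (s / r) * (r / f x)))//.
    by rewrite ltr_pM2l.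
  by rewrite mulrA -(mulrA (f x)) divfK ?gt_eqF// mulrC mulKf ?gt_eqF.
- apply: (@lt_le_trans _ _ (f x * (s / r))); last by rewrite ler_peMr// ltW.
  by rewrite ltr_pMr// ltr_pdivlMr// mul1r.
Qed.

(** * Integral representation and uniqueness *)

Lemma form_density_represents : represents (sup_density form_density) V.
Proof.
move=> f cf; apply/le_anti/andP; split; last first.
  apply/ereal_supP => _ [t t0 <-].
  have [t0'|tn0] := eqVneq t 0.
    by rewrite t0' mul0e lee_fin linear_form_ge0.
  have tp : 0 < t by rewrite lt_neqAle eq_sym tn0.
  rewrite -lee_pdivlMl//; apply: sup_density_le => [|x /=].
    by rewrite -EFinM lee_fin mulr_ge0 ?linear_form_ge0// invr_ge0.
  rewrite lte_fin => /ltW tf; rewrite lee_pdivlMl//.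
  exact: form_density_scale.
set I := shilkret_integral _ _.
have I_ub (t : R) : 0 <= t -> (t%:E *
    sup_density form_density [set x | (t%:E < (f x)%:E)%E] <= I)%E.
  by move=> t0; apply: ereal_sup_ubound; exists t.
have I0 : (0 <= I)%E by have := I_ub 0 (lexx 0); rewrite mul0e.
rewrite leNgt; apply/negP => /[dup] IV /(ereal_between I0)[s /andP[Is]].
rewrite lte_fin ltNge => /negP; apply.
(* Levels [I < q < r < s < V f]: the gap from [q] to [r] serves the density bound [dx], the gap from
   [r] to [s] the local domination. *)
have [r /andP[Ir]] := ereal_between I0 Is; rewrite lte_fin => rs.
have [q /andP[Iq]] := ereal_between I0 Ir; rewrite lte_fin => qr.
have q0 : 0 < q by rewrite -lte_fin (le_lt_trans _ Iq).
have r0 : 0 < r by exact: lt_trans qr.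
have s0 : 0 < s by exact: lt_trans rs.
have [ctf f0 kf] := cf.
have dx x : 0 < f x -> (form_density x < (r / f x)%:E)%E.
  move=> fx; rewrite ltNge; apply/negP => rd.
  (* The level [f x * (q / r)] lies strictly below [f x], so its superlevel set contains [x]; a
     density of at least [r / f x] there would force [q <= I]. *)
  have t0 : 0 < f x * (q / r) by rewrite mulr_gt0// divr_gt0.
  suff : (q%:E <= I)%E by rewrite leNgt Iq.
  apply: le_trans (I_ub _ (ltW t0)).
  rewrite -lee_pdivrMl//.
  apply: (@le_trans _ _ (form_density x)); last first.
    apply: sup_density_ub; rewrite /= lte_fin gtr_pMr//.
    by rewrite ltr_pdivrMr// mul1r.
  apply: le_trans rd; rewrite -EFinM lee_fin.
  rewrite invfM invf_div -mulrA mulrVK ?unitfE ?gt_eqF//.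
  by rewrite mulrC.
suff [g [cg Vg fg]] : exists g, [/\ Ccplus g, V g <= s
    & forall x, closure [set x | f x != 0] x -> f x <= g x].
  apply: le_trans Vg; apply: linear_form_mono => // x.
  have [->|fx] := eqVneq (f x) 0; first by case: cg.
  by apply: fg; exact: subset_closure.
apply: (compact_ind (P := fun A => exists g,
  [/\ Ccplus g, V g <= s & forall x, A x -> f x <= g x]) kf).
- by exists (fun=> 0); split=> //; [exact: Ccplus0|rewrite linear_form0 ltW].
- by move=> A B AB [g [cg Vg fg]]; exists g; split=> // x /AB/fg.
- move=> A B [g [cg Vg fg]] [h [ch Vh fh]]; exists (g \max h); split.
  + exact: Ccplus_max.
  + by case: hV => _ -> // _; rewrite ge_max Vg.
  + by move=> x [/fg|/fh] fx; rewrite le_max fx ?orbT.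
move=> x _; have [|g [cg Vg fg]] := @local_domination f x r s cf _ (@dx x).
  by rewrite r0.
exists [set y | f y < g y]; first by apply: lt_nbhs => //; case: cg.
by exists g; split=> //; [exact: ltW|move=> y /= /ltW].
Qed.

Lemma represents_singleton (mu : set E -> \bar R) :
  maxitive_measure mu -> regular_maxitive mu -> represents mu V ->
  forall x, mu [set x] = form_density x.
Proof.
move=> mu_max mu_reg mu_V x; have [mu0 _ _] := mu_max.
have fopen f (t : R) : Ccplus f -> open [set y | (t%:E < (EFin \o f) y)%E].
  move=> [ctf _ _]; rewrite openE => y /=; rewrite lte_fin => ty.
  have tfy : nbhs y [set z | t < f z].
    by apply: lt_nbhs => // z; exact: cvg_cst.
  by apply: filterS tfy => z /=; rewrite lte_fin.
apply/le_anti/andP; split.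
  apply/ereal_infP => _ [f [cf fx] <-].
  rewrite leNgt; apply/negP => Vm.
  have Vf0 := linear_form_ge0 cf.
  (* With [V f < r < s < mu [set x]], the level [r / s < 1] is exceeded by [f] at [x], so the
     integral is at least [(r / s) * s = r], a contradiction. A real [s] is used since [mu [set x]]
     may be infinite. *)
  have [r /andP[]] : exists r, ((V f)%:E < r%:E < mu [set x])%E.
    by apply: ereal_between.
  rewrite lte_fin => Vr rm.
  have r0 : 0 < r by exact: le_lt_trans Vr.
  have [s /andP[]] : exists s, (r%:E < s%:E < mu [set x])%E.
    by apply: ereal_between => //; rewrite lee_fin ltW.
  rewrite lte_fin => rs sm.
  have s0 : 0 < s by exact: lt_trans rs.
  have t0 : 0 < r / s by exact: divr_gt0.
  suff : (r%:E <= (V f)%:E)%E by rewrite lee_fin leNgt Vr.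
  rewrite (mu_V f cf); apply: le_ereal_sup_tmp.
  exists ((r / s)%:E * mu [set y | ((r / s)%:E < (EFin \o f) y)%E])%E.
    by exists (r / s) => //=; exact: ltW.
  rewrite -lee_pdivrMl// -EFinM invf_div mulrVK ?unitfE ?gt_eqF//.
  apply: (le_trans (ltW sm)); apply: maxitive_mono => //.
  - exact: set1_borel.
  - by apply: open_borel; exact: fopen.
  - move=> _ -> /=; rewrite lte_fin (lt_le_trans _ fx)//.
    by rewrite ltr_pdivrMr// mul1r.
have [_ ->] := mu_reg _ (set1_borel hE x).
apply/ereal_infP => _ [G [xG oG] <-].
(* A bump bounded by [1] and vanishing off [G] has integral at most [mu G]: superlevel sets are
   empty for [t >= 1] and lie in [G] for [t < 1]. *)
have [|f [cf fx f1 fG]] := @Ccplus_bump x G.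
  by apply: open_nbhs_nbhs; split=> //; exact: xG.
apply: ge_ereal_inf; exists (V f)%:E.
  by exists f => //; split; rewrite ?fx.
have mG := mu0 _ (open_borel oG).
rewrite (mu_V f cf); apply/ereal_supP => _ [t /= t0 <-].
have bt := open_borel (fopen f t cf).
have [t1|t1] := leP 1 t.
  rewrite [X in mu X](_ : _ = set0).
    by case: mu_max => _ -> _; rewrite mule0.
  by rewrite -subset0 => y /=; rewrite lte_fin ltNge (le_trans (f1 y) t1).
apply: (@le_trans _ _ (mu [set y | (t%:E < (EFin \o f) y)%E])).
  by rewrite gee_pMl// ?mu0// lee_fin ltW.
apply: maxitive_mono => //; first exact: open_borel.
move=> y /=; rewrite lte_fin => ty; apply: fG.
by rewrite /= gt_eqF// (le_lt_trans t0).
Qed.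

End LinearForm.

Theorem theorem9p3 (R : realType) (E : topologicalType)
    (lcE : locally_compact [set: E]) (hE : hausdorff_space E)
    (V : (E -> R) -> R) (hV : linear_form V) :
  exists nu : set E -> \bar R,
    [/\ [/\ maxitive_measure nu, regular_maxitive nu & represents nu V],
        forall mu : set E -> \bar R,
          [/\ maxitive_measure mu, regular_maxitive mu & represents mu V] ->
          forall B, borel B -> mu B = nu B
      & forall K, compact K -> (nu K < +oo)%E].
Proof.
exists (sup_density (form_density V)); split.
- split; [exact: sup_density_maxitive| |exact: form_density_represents].
  exact: sup_density_regular (form_density_usc hV).
- move=> mu [mu_max mu_reg mu_V] B bB.
  rewrite (regular_maxitive_sup_density hE mu_max mu_reg bB).
  congr sup_density; apply/funext => x.
  exact: represents_singleton.
- move=> K cK; apply: sup_density_compact cK.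
  + exact: form_density_ge0.
  + exact: form_density_usc.
  + exact: form_density_lty.
Qed.
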